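(* Let $Z$ be a hidden Markov model whose hidden Markov chain $Y$ (with transition matrix $\mathbb P=(p_{ij})_{i,j\in\mathcal Y}$) is irreducible. Suppose the cluster assumption holds: there exists a cluster $C\subset\mathcal Y$ such that the sub-stochastic matrix $\mathbb P_C=(p_{ij})_{i,j\in C}$ is primitive, i.e. $\mathbb P_C^R$ has only positive entries for some positive integer $R$. Then conditions A1 and A2 (stated in the context) hold.
   Context: Setting. $\mathcal X$ is a Polish space with Borel $\sigma$-field, $\mathcal Y=\{1,\dots,|\mathcal Y|\}$ is a finite set, $\mathcal Z=\mathcal X\times\mathcal Y$ with $\sigma$-field $\mathcal B(\mathcal X)\otimes2^{\mathcal Y}$; $\mu$ is a $\sigma$-finite measure on $\mathcal B(\mathcal X)$ and $c$ is the counting measure on $2^{\mathcal Y}$. $Z=\{(X_k,Y_k)\}_{k\ge1}$ is a homogeneous Markov chain on $\mathcal Z$ whose transition kernel has density $q(z'|z)$ with respect to $\mu\times c$, and $Z_1$ has a density with respect to $\mu\times c$. $Z$ is a hidden Markov model if $q(x',j|x,i)=p_{ij}f_j(x')$, where $\mathbb P=(p_{ij})$ is a transition matrix on $\mathcal Y$ and the $f_j$ are probability densities (emission densities) with respect to $\mu$. Put $G_i=\{x\in\mathcal X:f_i(x)>0\}$. A subset $C\subset\mathcal Y$ is called a cluster if $$\mu\Big[\big(\textstyle\bigcap_{i\in C}G_i\big)\setminus\big(\bigcup_{i\notin C}G_i\big)\Big]>0.$$ Notation. For $n\ge2$, $p_{ij}(x_{1:n})=\sum_{y_{1:n}:y_1=i,y_n=j}\prod_{k=2}^nq(x_k,y_k|x_{k-1},y_{k-1})$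 and $\mathcal Y^+(x_{1:n})=\{(i,j):p_{ij}(x_{1:n})>0\}$. For a set $A$ of vectors of length $r>1$, $A_{(k)}=\{x_k:x_{1:r}\in A\}$ and $A(x_1)=\{x_{2:r}:x_{1:r}\in A\}$. $Z$ is $\varphi$-irreducible, for a $\sigma$-finite $\varphi$, if $\varphi(A)>0$ implies $\sum_{k\ge2}P_z(Z_k\in A)>0$ for all $z\in\mathcal Z$, where $P_z$ is the law of $Z$ started at $Z_1=z$; $\psi$ denotes the maximal irreducibility measure (dominating every irreducibility measure). Conditions (with the same $r$ and $E$). A1: There exist an integer $r>1$ and a measurable set $E\subset\mathcal X^r$ such that $\mathcal Y^+:=\mathcal Y^+(x_{1:r})\ne\emptyset$ is the same for all $x_{1:r}\in E$, and $\mathcal Y^+=\mathcal Y^+_{(1)}\times\mathcal Y^+_{(2)}$. A2: $Z$ is $\psi$-irreducible with $\psi(E_{(1)}\times\mathcal Y^+_{(1)})>0$, and $\mu^{r-1}(E(x_1))>0$ for all $x_1\in E_{(1)}$. *)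

(* Defs.v *)
From HB Require Import structures.
From mathcomp Require Import all_boot all_order all_algebra.
From mathcomp Require Import all_classical all_reals all_analysis.

Set Implicit Arguments.
Unset Strict Implicit.
Unset Printing Implicit Defensive.

Import Order.TTheory GRing.Theory Num.Theory.
Import numFieldNormedType.Exports.

Local Open Scope classical_set_scope.
Local Open Scope ring_scope.
Local Open Scope ereal_scope.

Section polish.
Variables (R : realType) (T : topologicalType).

Definition is_distance (dist : T -> T -> R) : Prop :=
  [/\ (forall x y, 0 <= dist x y)%R,
      forall x y, dist x y = 0%R <-> x = y,
      forall x y, dist x y = dist y x &
      (forall x y z, dist x z <= dist x y + dist y z)%R].

Definition metrizes (dist : T -> T -> R) : Prop :=
  forall (x : T) (A : set T),
    nbhs x A <-> exists2 e : R, (0 < e)%R & [set y | (dist x y < e)%R] `<=` A.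

Definition complete_distance (dist : T -> T -> R) : Prop :=
  forall u : nat -> T,
    (forall e : R, (0 < e)%R -> exists N : nat, forall m n : nat,
       (N <= m)%N -> (N <= n)%N -> (dist (u m) (u n) < e)%R) ->
    exists l : T, u n @[n --> \oo] --> l.

Definition polish : Prop :=
  (exists dist : T -> T -> R,
     [/\ is_distance dist, metrizes dist & complete_distance dist]) /\
  (exists2 S : set T, countable S & dense S).

End polish.

Notation borel T := (g_sigma_algebraType (@open T)).

Section ordinal_measurable.
Variable n : nat.

HB.instance Definition _ := isPointed.Build 'I_n.+1 ord0.
HB.instance Definition _ := @isMeasurable.Build default_measure_display
  'I_n.+1 discrete_measurable discrete_measurable0
  discrete_measurableC discrete_measurableU.

End ordinal_measurable.

Notation states X m := (borel X * 'I_m.+1)%type.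

Definition prob_density d (T : measurableType d) (R : realType)
    (nu : set T -> \bar R) (g : T -> R) : Prop :=
  [/\ measurable_fun setT g, (forall x, 0 <= g x)%R &
      \int[nu]_x (g x)%:E = 1].

Section markov_chain.
Context d (T : measurableType d) (R : realType).

(* [q z' z] stands for the density q(z'|z) *)
Definition transition_density (nu : set T -> \bar R) (Q : R.-pker T ~> T)
    (q : T -> T -> R) : Prop :=
  forall z, prob_density nu (q ^~ z) /\
    forall A : set T, measurable A -> Q z A = \int[nu]_(z' in A) (q z' z)%:E.

(* [Z 0] is the first variable of the chain.
   P(Z_(n+1) \in A | Z_0, ..., Z_n) = Q(Z_n, A) almost surely, in the integrated
   form that defines the conditional expectation given sigma(Z_0, ..., Z_n). *)
Definition markov_chain d' (Omega : measurableType d')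
    (P : probability Omega R) (Q : R.-pker T ~> T)
    (Z : nat -> {RV P >-> T}) : Prop :=
  forall (n : nat) (B : set (n.+1.-tuple T)) (A : set T),
    measurable B -> measurable A ->
    let past := [set w | B [tuple Z i w | i < n.+1]] in
    P (past `&` Z n.+1 @^-1` A) = \int[P]_(w in past) Q (Z n w) A.

Definition has_density d' (Omega : measurableType d')
    (P : probability Omega R) (nu : set T -> \bar R)
    (W : {RV P >-> T}) : Prop :=
  exists2 g : T -> R, prob_density nu g &
    forall A : set T, measurable A ->
      distribution P W A = \int[nu]_(z in A) (g z)%:E.

Fixpoint kernel_iter (Q : R.-pker T ~> T) (n : nat) : R.-spker T ~> T :=
  if n is n'.+1 then mkcomp_noparam Q (kernel_iter Q n')
  else kdirac (@measurable_id _ T setT).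

(* P_z(Z_k \in A) for the chain started at Z_1 = z: here time starts at 1, so
   Z_k is reached after k - 1 transitions. *)
Definition law_at (Q : R.-pker T ~> T) (z : T) (k : nat) (A : set T) : \bar R :=
  kernel_iter Q k.-1 z A.

Definition phi_irreducible (Q : R.-pker T ~> T) (phi : set T -> \bar R)
    : Prop :=
  forall A : set T, measurable A -> 0 < phi A ->
  forall z : T, 0 < \sum_(2 <= k <oo) law_at Q z k A.

Definition maximal_irreducibility_measure (Q : R.-pker T ~> T)
    (psi : {sigma_finite_measure set T -> \bar R}) : Prop :=
  phi_irreducible Q psi /\
  forall phi : {sigma_finite_measure set T -> \bar R},
    phi_irreducible Q phi -> phi `<< psi.

End markov_chain.

Section matrices.
Variables (R : realType) (m : nat).
Implicit Types p : 'M[R]_m.+1.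

Definition stochastic p : Prop :=
  (forall i j, 0 <= p i j)%R /\ (forall i, \sum_j p i j = 1)%R.

Definition irreducible_mx p : Prop :=
  forall i j, exists2 n : nat, (0 < n)%N & (0 < (p ^+ n) i j)%R.

Definition primitive_mx (k : nat) (a : 'M[R]_k) : Prop :=
  exists2 n : nat, (0 < n)%N & forall i j, (0 < (a ^+ n) i j)%R.

Definition restrict_mx p (C : {set 'I_m.+1}) : 'M[R]_#|C| :=
  mxsub enum_val enum_val p.

End matrices.

Section hidden_markov_model.
Variables (R : realType) (X : ptopologicalType) (m : nat).
Local Notation Y := 'I_m.+1.
Local Notation BX := (borel X).
Local Notation Z := (states X m).
Variable mu : {sigma_finite_measure set BX -> \bar R}.

Definition mu_counting : set Z -> \bar R := mu \x @counting Y R.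

Definition hidden_markov_model (q : Z -> Z -> R) (p : 'M[R]_m.+1)
    (f : Y -> BX -> R) : Prop :=
  [/\ stochastic p, forall j, prob_density mu (f j) &
      forall x x' i j, q (x', j) (x, i) = (p i j * f j x')%R].

Definition is_cluster (f : Y -> BX -> R) (C : {set Y}) : Prop :=
  let G i := [set x | (0 < f i x)%R] in
  0 < mu ((\bigcap_(i in [set i | i \in C]) G i) `\`
          (\bigcup_(i in [set i | i \notin C]) G i)).

(* the n-fold product measure mu^n, for the product sigma-algebra on tuples *)
Fixpoint mu_pow (n : nat) : set (n.-tuple BX) -> \bar R :=
  match n with
  | 0 => fun A => \d_[tuple] A
  | n'.+1 => fun A =>
      (mu \x @mu_pow n') [set t : BX * n'.-tuple BX | A [tuple of t.1 :: t.2]]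
  end.

Section words.
(* Vectors x_{1:r} have length r = n.+1 and are indexed from 0: x_1 is [thead x]
   and the indices k.+1 and k below are those of x_{k+2} and x_{k+1}. *)
Variables (q : Z -> Z -> R) (n : nat).
Implicit Types (x : n.+1.-tuple BX) (E : set (n.+1.-tuple BX)).

Definition path_weight x (i j : Y) : R :=
  (\sum_(y : n.+1.-tuple Y | (thead y == i) && (tnth y ord_max == j))
     \prod_(k < n)
       q (tnth x (lift ord0 k), tnth y (lift ord0 k))
         (tnth x (widen_ord (leqnSn n) k), tnth y (widen_ord (leqnSn n) k)))%R.

Definition Yplus x : set (Y * Y) :=
  [set ij | (0 < path_weight x ij.1 ij.2)%R].

Definition heads E : set BX := [set thead x | x in E].

Definition head_section E (x1 : BX) : set (n.-tuple BX) :=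
  [set t : n.-tuple BX | E [tuple of x1 :: t]].

(* [Yp] is the common value of Y^+(x_{1:r}) for x_{1:r} in E *)
Definition condA1 E (Yp : set (Y * Y)) : Prop :=
  [/\ (1 < n.+1)%N, measurable E, Yp !=set0,
      forall x, E x -> Yplus x = Yp &
      Yp = (fst @` Yp) `*` (snd @` Yp)].

(* A projection of a measurable set need not be measurable, while measures are
   only meaningful on measurable sets: measurability of the rectangle is part of
   the claim that it has positive psi-measure. *)
Definition condA2 (Q : R.-pker Z ~> Z) E
    (Yp : set (Y * Y)) : Prop :=
  (exists psi : {sigma_finite_measure set Z -> \bar R},
     [/\ maximal_irreducibility_measure Q psi,
         measurable (heads E `*` (fst @` Yp)) &
         0 < psi (heads E `*` (fst @` Yp))]) /\
  (forall x1 : BX, heads E x1 -> 0 < mu_pow (head_section E x1)).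

End words.
End hidden_markov_model.

(* Main.v *)
Require Import Defs.
From HB Require Import structures.
From mathcomp Require Import all_boot all_order all_algebra.
From mathcomp Require Import all_classical all_reals all_analysis.
From mathcomp Require Import measurable_realfun.

(** Let [C] be a cluster such that [restrict_mx p C ^+ r] has positive entries,
    and let [S] be the set, of positive [mu]-measure, of those points at which
    the densities [f l], [l \in C], are positive and all the other ones vanish.
    A point of [S] can be emitted by the states of [C] and by no other: along
    a word [x_1 ... x_(r+2)] over [S] a hidden path has positive weight if and
    only if its [p]-transitions are all possible and it stays in [C] from its
    second state on; its first state is free, because the weight does not
    involve the density at [x_1]. So take for [E] the words of length [r + 2]
    over [S].

    Let [D] be the set of states from which [p] can enter [C] in one step. A
    pair [(i, j)] is joined by such a path if and only if [i \in D] and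
    [j \in C]: enter [C] in one step at some [k], then go from [k] to [j] inside
    [C] in [r] steps, which the choice of [r] allows for all [k] and [j].
    Entering [C] first is what makes [Y^+] the rectangle [D * C] (words of
    length [r + 1] might not do), and this is [Yplus_cluster].

    The kernel [Q] depends on the state [(x, i)] only through [i], so
    [psi A = \sum_i Q (x0, i) A], for any fixed [x0], vanishes if and only if
    [Q z A] does for every [z]. If [psi A = 0] then no iterate of [Q] charges
    [A], whence every irreducibility measure is dominated by [psi]. If
    [psi A > 0] then
    [Q (x0, j) A > 0] for some [j]; following a path of positive transitions of
    [p] from [i] to [j] and then making one more step, the chain started at
    [(x, i)] charges [A]. So [psi] is a maximal irreducibility measure. It
    charges [S * D], because [C] is included in [D], some state leads to a given
    element of [C], and the emission density of that element is positive on
    [S]. The sections of [E] are powers of [S], of positive measure. *)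

Set Implicit Arguments.
Unset Strict Implicit.
Unset Printing Implicit Defensive.

Import Order.TTheory GRing.Theory Num.Theory.
Import numFieldNormedType.Exports.

Local Open Scope classical_set_scope.
Local Open Scope ring_scope.
Local Open Scope ereal_scope.

(** * Integration of nonnegative functions *)

Section integration.
Context d (T : measurableType d) (R : realType).

Lemma integral_gt0 (mu : {measure set T -> \bar R}) (A B : set T)
    (g : T -> \bar R) :
  measurable A -> measurable B -> A `<=` B -> measurable_fun setT g ->
  (forall x, 0 <= g x) -> (forall x, A x -> 0 < g x) -> 0 < mu A ->
  0 < \int[mu]_(x in B) g x.
Proof.
move=> mA mB AB mg g_ge0 g_gt0; rewrite measure_gt0 => /eqP muA.
have mgB D : measurable_fun D g by apply: measurable_funTS.
apply: (@lt_le_trans _ _ (\int[mu]_(x in A) g x)); last first.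
  exact: ge0_subset_integral.
rewrite lt0e integral_ge0 ?andbT//.
apply/eqP => int0; apply: muA.
have /(ae_eq_integral_abs mu mA (mgB A))[N [mN N0 AN]] :
    \int[mu]_(x in A) `|g x| = 0.
  by rewrite -int0; apply: eq_integral => x _; rewrite gee0_abs.
apply: (subset_measure0 mA mN _ N0) => x Ax; apply: AN => /= /(_ Ax) gx0.
by have := g_gt0 _ Ax; rewrite gx0 ltxx.
Qed.

End integration.

(** * Paths in nonnegative matrices *)

Section nonnegative_matrices.
Local Open Scope ring_scope.
Variables (R : realType) (k : nat).
Implicit Types a b : 'M[R]_k.

Lemma mulmx_gt0_ex a b i j :
  (forall i j, 0 <= a i j) -> (forall i j, 0 <= b i j) ->
  0 < (a *m b) i j -> exists l, 0 < a i l /\ 0 < b l j.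
Proof.
move=> a0 b0; rewrite mxE => ab.
have [||l] := @psumr_neq0P _ _ xpredT (fun l => a i l * b l j).
- by move=> l _; rewrite mulr_ge0.
- by apply/eqP; rewrite gt_eqF.
move=> /= abl; exists l.
by split; rewrite lt_def ?a0 ?b0 andbT; apply: contraTneq abl => ->;
  rewrite ?mul0r ?mulr0 ltxx.
Qed.

Lemma expmx_ge0 a n : (forall i j, 0 <= a i j) -> forall i j, 0 <= (a ^+ n) i j.
Proof.
move=> a0; elim: n => [|n IH] i j; first by rewrite expr0 mxE ler0n.
by rewrite exprS mxE sumr_ge0// => l _; rewrite mulr_ge0.
Qed.

(** An entry of [a ^+ n] is the sum over the paths of length [n] of the products
    of the entries of [a] along them. *)
Lemma expmx_gt0_path a n i j : (forall i j, 0 <= a i j) -> 0 < (a ^+ n) i j ->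
  exists s, [/\ size s = n, path (fun u v => 0 < a u v) i s & last i s = j].
Proof.
move=> a0; elim: n i => [|n IH] i.
  by rewrite expr0 mxE ltr0n lt0b => /eqP <-; exists [::].
rewrite exprS => /(mulmx_gt0_ex a0 (expmx_ge0 n a0))[l [ail /IH[s [ss ps <-]]]].
by exists (l :: s); rewrite /= ss ail.
Qed.

End nonnegative_matrices.

Lemma restrict_mx_path (R : realType) (m : nat) (p : 'M[R]_m.+1)
    (C : {set 'I_m.+1}) u s :
  path (fun u v => 0 < restrict_mx p C u v)%R u s ->
  path (fun i j => (0 < p i j)%R && (j \in C)) (enum_val u) (map enum_val s).
Proof.
by apply: homo_path => {}u v; rewrite /restrict_mx mxE enum_valP andbT.
Qed.

(** * Powers of a set in the product measure *)

Definition set_pow (T : Type) (S : set T) (n : nat) : set (n.-tuple T) :=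
  [set t | forall k, S (tnth t k)].
Arguments set_pow {T} S n _.

Lemma measurable_set_pow d (T : measurableType d) (S : set T) n :
  measurable S -> measurable (set_pow S n).
Proof.
move=> mS.
rewrite (_ : set_pow S n =
             \bigcap_(k in [set: 'I_n]) ((tnth (T:=_))^~ k @^-1` S)).
  apply: fin_bigcap_measurable => // k _; rewrite -[X in measurable X]setTI.
  exact: measurable_tnth.
by apply/seteqP; split => t /= St k; [move=> _|]; exact: St.
Qed.

Lemma set_pow_cons (T : Type) (S : set T) n x (t : n.-tuple T) :
  set_pow S _ [tuple of x :: t] <-> S x /\ set_pow S _ t.
Proof.
split=> [St|[Sx St] k]; last first.
  by have [l ->|->] := unliftP ord0 k; rewrite ?tnth0// tnthS.
by split=> [|k]; [have := St ord0|have := St (lift ord0 k)];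
  rewrite ?tnth0// tnthS.
Qed.

Section product_power.
Variables (R : realType) (X : ptopologicalType).
Variable mu : {sigma_finite_measure set (borel X) -> \bar R}.

Lemma mu_pow0 n : @mu_pow R X mu n set0 = 0.
Proof.
elim: n => [|n IH] /=; first by rewrite measure0.
apply: integral0_eq => x _ /=.
rewrite -[RHS]IH; congr (mu_pow mu _).
by apply/seteqP; split => t //; rewrite /xsection/= inE.
Qed.

Lemma mu_pow_gt0 (S : set (borel X)) n : measurable S -> 0 < mu S ->
  0 < @mu_pow R X mu n (set_pow S n).
Proof.
move=> mS muS; elim: n => [|n IH] /=.
  by rewrite diracE mem_set// => -[].
rewrite /product_measure1.
rewrite (eq_integral (cst (mu_pow mu (set_pow S n)) \_ S)); last first.
  move=> x _ /=; rewrite patchE; case: ifPn => [|/negP]; rewrite inE => Sx.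
    congr (mu_pow mu _); apply/seteqP; split => t; rewrite /xsection/= ?inE/=.
      by move/set_pow_cons => [].
    by move=> St; apply/set_pow_cons.
  rewrite -[RHS]/(0 : \bar R) -(mu_pow0 n); congr (mu_pow mu _); apply/seteqP.
  by split => t//; rewrite /xsection/= inE/= => /set_pow_cons[].
by rewrite -integral_mkcond integral_cst// mule_gt0.
Qed.

End product_power.

(** * Words observed in a cluster set *)

Section words.
Local Open Scope ring_scope.
Variables (R : realType) (X : ptopologicalType) (m : nat).
Variables (mu : {sigma_finite_measure set (borel X) -> \bar R}).
Variables (q : states X m -> states X m -> R) (p : 'M[R]_m.+1).
Variable f : 'I_m.+1 -> borel X -> R.
Hypothesis hHMM : hidden_markov_model mu q p f.

(** The weight is a sum of nonnegative products, one for each hidden path, and a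
    product is positive exactly when all its factors are. The assumption bears
    on the letters of [x] from the second on, since a factor involves the
    emission density of the state it arrives in. *)
Lemma path_weight_gt0 (C : {set 'I_m.+1}) n (x : n.+1.-tuple (borel X)) i j :
  (forall (k : 'I_n) l, (0 < f l (tnth x (lift ord0 k))) = (l \in C)) ->
  0 < path_weight q x i j <->
  exists s, [/\ size s = n, path (fun u v => (0 < p u v) && (v \in C)) i s &
                last i s = j].
Proof.
case: hHMM => -[p0 _] fd qE xC.
have f0 l y : 0 <= f l y by have [_ + _] := fd l; apply.
have q_gt0 (k : 'I_n) u v y :
    (0 < q (tnth x (lift ord0 k), v) (y, u)) = (0 < p u v) && (v \in C).
  rewrite qE -(xC k) !lt_def p0 f0 mulr_ge0// !andbT mulf_eq0 negb_or.
  by rewrite andbC.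
have q0 z z' : 0 <= q z z' by case: z z' => [? ?] [? ?]; rewrite qE mulr_ge0.
have nthS (y : n.+1.-tuple 'I_m.+1) (k : 'I_n) :
    tnth y (lift ord0 k) = nth i (behead y) k.
  by rewrite (tnth_nth i) nth_behead.
have nthW (y : n.+1.-tuple 'I_m.+1) (k : 'I_n) :
    tnth y (widen_ord (leqnSn n) k) = nth i (thead y :: behead y) k.
  by rewrite (tnth_nth i)/= {1}(tuple_eta y).
have last_tnth (y : n.+1.-tuple 'I_m.+1) : tnth y ord_max = last i y.
  by rewrite -nth_last size_tuple (tnth_nth i).
split=> [w_gt0|[s [ss sC sj]]].
  have /(psumr_neq0P _)[|y /andP[/andP[/eqP yi /eqP yj] wy]] :
      path_weight q x i j <> 0 by apply/eqP; rewrite gt_eqF.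
    by move=> y _; apply: prodr_ge0.
  have sy : size (behead y) = n by rewrite size_behead size_tuple.
  exists (behead y); split => //; last first.
    by rewrite -yj last_tnth [in RHS](tuple_eta y)/= yi.
  apply/(pathP i) => k; rewrite sy => kn.
  have /= := nthS y (Ordinal kn); have /= := nthW y (Ordinal kn).
  rewrite yi => <- <-; set kn' := Ordinal kn.
  rewrite -(q_gt0 kn' _ _ (tnth x (widen_ord (leqnSn n) kn'))).
  rewrite lt_def q0 andbT.
  by move/prodf_neq0 : (lt0r_neq0 wy); apply.
pose y : n.+1.-tuple 'I_m.+1 := @Tuple _ _ (i :: s) (introT eqP (congr1 S ss)).
rewrite /path_weight (bigD1 y)/=; last first.
  by rewrite last_tnth/= sj !eqxx.
apply: ltr_wpDr; first by apply: sumr_ge0 => ? _; exact: prodr_ge0.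
apply: prodr_gt0 => k _; rewrite q_gt0 nthS nthW/=.
by move/(pathP i) : sC => /(_ k); rewrite ss; exact.
Qed.

(** The word has one more letter than the paths of length [n] inside [C] need:
    the additional first step goes from an arbitrary state into [C], and the
    remaining [n] steps can then reach any element of [C]. *)
Lemma Yplus_cluster (C : {set 'I_m.+1}) n (x : n.+2.-tuple (borel X)) :
  (forall u v, exists s, [/\ size s = n,
     path (fun u v => 0 < restrict_mx p C u v) u s & last u s = v]) ->
  (forall k l, (0 < f l (tnth x k)) = (l \in C)) ->
  Yplus q x = [set i | exists2 k, k \in C & 0 < p i k] `*` [set j | j \in C].
Proof.
move=> hC xC.
apply/seteqP; split=> -[i j]; rewrite /Yplus/=.
  move/(path_weight_gt0 _ _ (fun k => xC (lift ord0 k))).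
  move=> [[|l s] [//]] /= _ /andP[/andP[pil lC] sC] <-.
  split; first by exists l.
  elim: s l {pil} lC sC => //= l' s IH l _ /andP[/andP[_ l'C]]; exact: IH.
move=> [[k kC pik] jC]; apply/(path_weight_gt0 _ _ (fun k => xC (lift ord0 k))).
have [s [ss sC sj]] := hC (enum_rank_in kC k) (enum_rank_in kC j).
exists (k :: map enum_val s); split; rewrite /= ?size_map ?ss// ?pik ?kC/=.
  by have := restrict_mx_path sC; rewrite enum_rankK_in.
by rewrite -{1}(enum_rankK_in kC kC) last_map sj enum_rankK_in.
Qed.

End words.

(** * Iterates of a kernel *)

Section kernel_iterates.
Context d (T : measurableType d) (R : realType).
Variable Q : R.-pker T ~> T.

Lemma kernel_iterS n z A :
  kernel_iter Q n.+1 z A = \int[Q z]_z' kernel_iter Q n z' A.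
Proof. by []. Qed.

Lemma kernel_iter1 z A : measurable A -> kernel_iter Q 1 z A = Q z A.
Proof.
move=> mA; rewrite kernel_iterS /=.
rewrite (eq_integral (fun z' => (\1_A z')%:E)); last by move=> z' _.
by rewrite integral_indic// setIT.
Qed.

Lemma kernel_iter_null A : measurable A -> (forall z, Q z A = 0) ->
  forall n z, kernel_iter Q n.+1 z A = 0.
Proof.
move=> mA QA0; elim=> [|n IH] z; first by rewrite kernel_iter1.
by rewrite kernel_iterS; apply: integral0_eq => z' _.
Qed.

End kernel_iterates.

(** The product measure of [mu] and the counting measure is a measure only for a
    [sigma_finite_measure] structure on the second factor. *)
Section counting_ordinal.
Variables (R : realType) (m : nat).

Lemma sigma_finite_counting_ordinal :
  sigma_finite [set: 'I_m.+1] (@counting 'I_m.+1 R).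
Proof.
apply: fin_num_fun_sigma_finite; first by rewrite measure0.
by move=> A _; rewrite /counting asboolT//; exact: finite_finset.
Qed.

HB.instance Definition _ := @Measure_isSigmaFinite.Build _ 'I_m.+1 R
  (@counting 'I_m.+1 R) sigma_finite_counting_ordinal.

End counting_ordinal.

(** * The maximal irreducibility measure of a hidden Markov model *)

Section hidden_markov_kernel.
Variables (R : realType) (X : ptopologicalType) (m : nat).
Variables (mu : {sigma_finite_measure set (borel X) -> \bar R}).
Variables (q : states X m -> states X m -> R) (p : 'M[R]_m.+1).
Variable Q : R.-pker (states X m) ~> (states X m).
Variable f : 'I_m.+1 -> borel X -> R.
Hypothesis hQ : transition_density (mu_counting mu) Q q.
Hypothesis hHMM : hidden_markov_model mu q p f.

(** [q (x', j) (x, i) = p i j * f j x'] does not depend on [x]. *)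
Lemma transition_hidden x x' i A : measurable A -> Q (x, i) A = Q (x', i) A.
Proof.
case: hHMM => _ _ qE mA; rewrite (hQ (x, i)).2// (hQ (x', i)).2//.
by apply: eq_integral => -[y j] _; rewrite !qE.
Qed.

Lemma transition_gt0 x i j (S : set (borel X)) : measurable S -> 0 < mu S ->
  (forall y, S y -> (0 < f j y)%R) -> (0 < p i j)%R ->
  0 < Q (x, i) (S `*` [set j]).
Proof.
case: hHMM => _ _ qE mS muS fS pij.
have [[mq q0 _] QE] := hQ (x, i).
have mSj : measurable (S `*` [set j]) by exact: measurableX.
rewrite QE//; apply: (integral_gt0 (A := S `*` [set j])) => //.
- exact/measurable_EFinP.
- by move=> [y k] [/= Sy ->]; rewrite qE lte_fin mulr_gt0// fS.
- rewrite /= [ltRHS]product_measure1E// mule_gt0//.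
  rewrite -[ltRHS]/(counting [set j]) /counting asboolT// fset_set1.
  by rewrite finmap.cardfs1 lte_fin.
Qed.

Lemma measurable_emission_support j : measurable [set y | (0 < f j y)%R].
Proof.
case: hHMM => _ fd _; have [mf _ _] := fd j.
rewrite (_ : [set _ | _] = [set: borel X] `&` f j @^-1` `]0%R, +oo[).
  exact: mf.
by rewrite setTI; apply/seteqP; split=> y /=; rewrite in_itv/= andbT.
Qed.

(** Otherwise the probability density [f j] would have integral [0]. *)
Lemma emission_support_gt0 j : 0 < mu [set y | (0 < f j y)%R].
Proof.
case: hHMM => _ fd _; have [mf f0 f1] := fd j.
have mG : measurable [set y | (0 < f j y)%R].
  exact: measurable_emission_support.
rewrite measure_gt0; apply/eqP => muG.
suff : \int[mu]_y (f j y)%:E = 0 by rewrite f1 => /eqP; rewrite onee_eq0.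
rewrite (ge0_negligible_integral mG)//; last 2 first.
- exact/measurable_EFinP.
- by move=> y _; rewrite lee_fin.
apply: integral0_eq => y [_ /negP]; rewrite -leNgt => fy.
by congr EFin; apply/eqP; rewrite eq_le fy f0.
Qed.

(** The first transition of the path reaches hidden state [j] with positive
    probability, whatever the observed component [y]; from each such [(y, j)]
    the induction hypothesis applies, thanks to [transition_hidden]. *)
Lemma kernel_iter_gt0 x i s A : measurable A ->
  path (fun u v => 0 < p u v)%R i s -> 0 < Q (x, last i s) A ->
  0 < kernel_iter Q (size s).+1 (x, i) A.
Proof.
move=> mA; elim: s i x => [|j s IH] i x; first by rewrite kernel_iter1.
move=> /= /andP[pij sp] QA.
rewrite [ltRHS](@kernel_iterS _ _ _ Q (size s).+1).
have mG := measurable_emission_support j.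
apply: (integral_gt0 (A := [set y | (0 < f j y)%R] `*` [set j])) => //.
- exact: measurableX.
- exact: measurable_kernel.
- by move=> [y k] [/= _ ->]; apply: IH => //; rewrite (transition_hidden _ x).
- exact: (transition_gt0 _ mG (emission_support_gt0 j)).
Qed.

(** One observed component stands for all of them, by [transition_hidden]; this
    leaves a finite sum, so the measure is finite. *)
Definition hidden_sum_measure : set (states X m) -> \bar R :=
  msum (fun k => Q (point, inord k)) m.+1.

HB.instance Definition _ := Measure.on hidden_sum_measure.

Lemma hidden_sum_measure_fin_num : fin_num_fun hidden_sum_measure.
Proof.
move=> A mA; rewrite /hidden_sum_measure/= /msum; apply/sum_fin_numP => k _ _.
exact: kernel_finite_transition.
Qed.

HB.instance Definition _ := Measure_isFinite.Build _ _ _ hidden_sum_measure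
  hidden_sum_measure_fin_num.

Lemma hidden_sum_measure_ge i A : Q (point, i) A <= hidden_sum_measure A.
Proof.
by rewrite /hidden_sum_measure/= /msum (bigD1 i)//= inord_val leeDl ?sume_ge0.
Qed.

Lemma hidden_sum_measure_null A : measurable A ->
  hidden_sum_measure A = 0 <-> forall z, Q z A = 0.
Proof.
move=> mA; split=> [A0 [x i]|Q0]; last first.
  by rewrite /hidden_sum_measure/= /msum big1.
rewrite (transition_hidden _ point)//; apply/eqP.
by rewrite -measure_le0 -A0 hidden_sum_measure_ge.
Qed.

Lemma hidden_sum_measure_irreducible :
  irreducible_mx p -> phi_irreducible Q hidden_sum_measure.
Proof.
case: hHMM => -[p0 _] _ _ p_irr A mA psiA [x i].
have [j QA] : exists j, 0 < Q (point, j) A.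
  move: psiA; rewrite measure_gt0 => /eqP psiA.
  apply: contrapT => /forallNP QA0; apply: psiA.
  apply/hidden_sum_measure_null => // -[y k].
  rewrite (transition_hidden _ point)//; apply/eqP.
  by rewrite -measure_le0 leNgt; apply/negP; exact: QA0.
have [n n_gt0 /(expmx_gt0_path p0)[s [_ sp sj]]] := p_irr i j.
(* Time starts at 1 and one more step than in the path is needed: the relevant
   term is the one of index [(size s).+2]. *)
apply: (@lt_le_trans _ _ (\sum_(2 <= k < (size s).+3) law_at Q (x, i) k A)).
  2: exact: nneseries_lim_ge.
rewrite big_nat_recr//=; apply: lt_le_trans (leeDr _ (sume_ge0 _ _)) => //.
rewrite /law_at/=; apply: (kernel_iter_gt0 mA sp).
by rewrite (transition_hidden _ point) ?sj.
Qed.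

(** A set that is null for all one-step transitions is never visited after the
    start, so an irreducibility measure cannot charge it. *)
Lemma hidden_sum_measure_maximal (phi : {measure set (states X m) -> \bar R}) :
  phi_irreducible Q phi -> phi `<< hidden_sum_measure.
Proof.
move=> phi_irr; apply/null_content_dominatesP => A mA.
move=> /(hidden_sum_measure_null mA) QA0.
apply/eqP; rewrite -measure_le0 leNgt; apply/negP => /(phi_irr _ mA)/(_ point).
rewrite eseries0 ?ltxx// => -[|[|k]]// _ _.
exact: kernel_iter_null.
Qed.

End hidden_markov_kernel.

(** * Conditions on the cluster words *)

Theorem lemma4p1 (R : realType) (X : ptopologicalType) (hX : polish R X)
    (m : nat) (mu : {sigma_finite_measure set (borel X) -> \bar R})
    (q : states X m -> states X m -> R)
    (Q : R.-pker (states X m) ~> (states X m))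
    (hQ : transition_density (mu_counting mu) Q q)
    (d : measure_display) (Omega : measurableType d) (P : probability Omega R)
    (Z : nat -> {RV P >-> (states X m)})
    (hZ : markov_chain Q Z)
    (hZ1 : has_density (mu_counting mu) (Z 0%N))
    (p : 'M[R]_m.+1) (f : 'I_m.+1 -> borel X -> R)
    (hHMM : hidden_markov_model mu q p f)
    (hirr : irreducible_mx p)
    (hcluster : exists C : {set 'I_m.+1},
      [/\ C != finset.set0, is_cluster mu f C & primitive_mx (restrict_mx p C)]) :
  exists (n : nat) (E : set (n.+1.-tuple (borel X)))
         (Yp : set ('I_m.+1 * 'I_m.+1)),
    condA1 q E Yp /\ condA2 mu Q E Yp.
Proof.
have [[p0 _] _ _] := hHMM.
have [C [/set0Pn[c cC] + [r r_gt0 Cr]]] := hcluster.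
rewrite /is_cluster; set S := (X in mu X) => muS.
have mS : measurable S.
  apply: measurableD.
    apply: fin_bigcap_measurable => // i _.
    exact: (measurable_emission_support hHMM).
  apply: fin_bigcup_measurable => // i _.
  exact: (measurable_emission_support hHMM).
have fS y l : S y -> (0 < f l y)%R = (l \in C).
  move=> [yC yNC]; apply/idP/idP => [fl|/yC//].
  by apply: contrapT => /negP lC; apply: yNC; exists l.
have C_path u v : exists s, [/\ size s = r,
    path (fun u v => 0 < restrict_mx p C u v)%R u s & last u s = v].
  by apply: expmx_gt0_path => // i j; rewrite mxE.
pose D := [set i | exists2 k, k \in C & (0 < p i k)%R].
have cD : D c.
  have [[|v s] [ss]] := C_path (enum_rank_in cC c) (enum_rank_in cC c).
    by rewrite -ss in r_gt0.
  move=> /= /andP[+ _] _; rewrite mxE enum_rankK_in// => pcv.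
  by exists (enum_val v) => //; exact: enum_valP.
pose E := set_pow S r.+2.
pose Yp := D `*` [set j | j \in C].
have Yp1 : fst @` Yp = D.
  apply/seteqP; split=> [_ [[i j] [/= Di _] <-]//|i Di].
  by exists (i, c).
have Yp2 : snd @` Yp = [set j | j \in C].
  apply/seteqP; split=> [_ [[i j] [_ /= jC] <-]//|j jC].
  by exists (c, j).
have headsE : heads E = S.
  apply/seteqP; split=> [_ [t St <-]|x Sx]; first exact: St.
  exists [tuple of nseq r.+2 x]; first by move=> k; rewrite tnth_nseq.
  by rewrite /thead tnth_nseq.
exists r.+1, E, Yp; split; split.
- by [].
- exact: measurable_set_pow.
- by exists (c, c).
- by move=> x Ex; apply: (Yplus_cluster hHMM C_path) => k l; exact: fS.
- by rewrite Yp1 Yp2.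
- exists (hidden_sum_measure Q).
  have mSD : measurable (S `*` D) by exact: measurableX.
  rewrite headsE Yp1; split => //.
    split; first exact: (hidden_sum_measure_irreducible hQ hHMM hirr).
    move=> phi phi_irr.
    exact: (hidden_sum_measure_maximal hQ hHMM phi_irr).
  (* The last step of a path from c to itself provides a state leading to c. *)
  have [n n_gt0 /(expmx_gt0_path p0)[s [sn]]] := hirr c c.
  case/lastP: s sn => [|s c'] sn; first by rewrite -sn in n_gt0.
  rewrite last_rcons rcons_path => /andP[_ /= +] c'E; rewrite c'E => pc.
  apply: lt_le_trans (hidden_sum_measure_ge Q (last c s) _).
  apply: (@lt_le_trans _ _ (Q (point, last c s) (S `*` [set c]))).
    by apply: (transition_gt0 hQ hHMM) => // y /fS ->.
  apply: le_measure; rewrite ?inE//; first exact: measurableX.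
  by move=> [y j] [/= Sy ->].
- move=> x1; rewrite headsE => Sx1.
  rewrite (_ : head_section E x1 = set_pow S r.+1); first exact: mu_pow_gt0.
  apply/seteqP; split => t /=; first by move=> /set_pow_cons[].
  by move=> St; exact/set_pow_cons.
Qed.
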